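(* Let $P$ and $Q$ be two $d$-dimensional convex lattice polytopes in $\mathbb{R}^d$. Then $P$ and $Q$ are affinely equivalent if and only if they have the same number $n$ of vertices and the vertices can be ordered as $\mathrm{vert}(P)=\{p_1,\dots,p_n\}$ and $\mathrm{vert}(Q)=\{q_1,\dots,q_n\}$ in such a way that the primitive volume vectors of $(p_1,\dots,p_n)$ and $(q_1,\dots,q_n)$ are equal (a primitive volume vector being determined up to sign).
   Context: A convex lattice polytope in $\mathbb{R}^d$ is the convex hull of a finite subset of $\mathbb{Z}^d$. Two $d$-dimensional convex lattice polytopes $P_1,P_2$ are affinely equivalent if there are $A\in\mathbb{R}^{d\times d}$ and $\mathbf{v}\in\mathbb{R}^d$ such that the map $\tau(x)=xA+\mathbf{v}$ (points as row vectors) satisfies $\tau(P_1)=P_2$. For an ordered finite set $(p_1,\dots,p_n)$ of points of $\mathbb{Z}^d$, $n\ge d+1$, the volume vector is the integer vector $w=(w_{i_1,\dots,i_{d+1}})_{1\le i_1<\dots<i_{d+1}\le n}\in\mathbb{Z}^{\binom{n}{d+1}}$ with $$w_{i_1,\dots,i_{d+1}}=\det\begin{pmatrix}1&\cdots&1\\ p_{i_1}&\cdots&p_{i_{d+1}}\end{pmatrix}$$ (points as columns in this determinant). If $w=kw'$ with $k$ an integer (possibly negative) and $w'$ a primitive integer vector (coordinates with greatest common divisor $1$), then $w'$ is called the primitive volume vector; it is determined up to sign. *)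

(* Defs.v *)
From HB Require Import structures.
From mathcomp Require Import all_boot all_order all_algebra.
From mathcomp Require Import boolp classical_sets reals convex.

Set Implicit Arguments.
Unset Strict Implicit.
Unset Printing Implicit Defensive.

Import Order.TTheory GRing.Theory Num.Theory.
Local Open Scope classical_set_scope.
Local Open Scope ring_scope.

Definition of_lattice (R : realType) (d : nat) (p : 'rV[int]_d) : 'rV[R]_d :=
  map_mx intr p.

Definition convex_hull (R : realType) (d : nat) (A : set 'rV[R]_d) :
    set 'rV[R]_d :=
  smallest (@convex_set R 'rV[R]_d) A.

Definition affine_hull (R : realType) (d : nat) (A : set 'rV[R]_d) :
    set 'rV[R]_d :=
  [set x | exists m (a : 'I_m -> R) (y : 'I_m -> 'rV[R]_d),
     [/\ forall i, A (y i), \sum_i a i = 1 & x = \sum_i a i *: y i]].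

Definition has_dim (R : realType) (d : nat) (A : set 'rV[R]_d) (k : nat) :
    Prop :=
  exists (x0 : 'rV[R]_d) (U : {vspace 'rV[R]_d}),
    \dim U = k /\ affine_hull A = [set x0 + u | u in [set` U]].

Definition lattice_polytope (R : realType) (d : nat) (P : set 'rV[R]_d) :
    Prop :=
  exists s : seq 'rV[int]_d, P = convex_hull (@of_lattice R d @` [set` s]).

(* The vertices of a polytope are its extreme points. *)
Definition vertices (R : realType) (d : nat) (P : set 'rV[R]_d) :
    set 'rV[R]_d :=
  [set x | P x /\ forall (y z : 'rV[R]_d) (t : R), P y -> P z -> 0 < t < 1 ->
     x = t *: y + (1 - t) *: z -> y = z].

Definition affinely_equivalent (R : realType) (d : nat)
    (P Q : set 'rV[R]_d) : Prop :=
  exists (A : 'M[R]_d) (v : 'rV[R]_d), [set x *m A + v | x in P] = Q.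

Definition vertex_ordering (R : realType) (d n : nat) (P : set 'rV[R]_d)
    (p : 'I_n -> 'rV[int]_d) : Prop :=
  injective p /\ range (fun i => of_lattice R (p i)) = vertices P.

Definition increasing (n k : nat) (t : k.-tuple 'I_n) : bool :=
  sorted ltn [seq val i | i <- t].

(* Coordinates of the volume vector are indexed by increasing sequences
   i_1 < ... < i_{d+1}; there are 'C(n, d.+1) of them. *)
Definition vol_index (n d : nat) : finType :=
  {t : d.+1.-tuple 'I_n | increasing t}.

Definition volume_vector (n d : nat) (p : 'I_n -> 'rV[int]_d) :
    {ffun vol_index n d -> int} :=
  [ffun I : vol_index n d =>
     \det (col_mx (const_mx 1 : 'rV[int]_(1 + d))
                  (\matrix_(i < d, j < 1 + d) p (tnth (val I) j) 0 i))].

Definition primitive (I : finType) (w : {ffun I -> int}) : Prop :=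
  \big[gcdn/0%N]_(i : I) `|w i|%N = 1%N.

(* The multiplier k may be negative, so w' is determined only up to sign. *)
Definition primitive_volume_vector (n d : nat) (p : 'I_n -> 'rV[int]_d)
    (w' : {ffun vol_index n d -> int}) : Prop :=
  primitive w' /\ exists k : int, volume_vector p = [ffun I => k * w' I].

(* Main.v *)
(** An affine map x |-> x A + v multiplies every maximal minor of the matrix
with rows (1, p_i) by det A, so it rescales the volume vector, and a nonzero
integer vector and its integral multiples by real scalars share a primitive
vector.  Conversely, full dimension makes some maximal minor, say with rows I,
nonzero, and Cramer's rule writes the coordinates of (1, p_j) in the basis
(1, p_i), i in I, as quotients of maximal minors.  These quotients are the same
for p and q when the volume vectors are proportional, so the affine map sending
p_i to q_i for i in I sends every p_j to q_j, hence the convex hull P of the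
vertices p_j to Q. *)

Require Import Defs.
From mathcomp Require Import all_boot all_order all_algebra all_fingroup.
From mathcomp Require Import boolp classical_sets reals convex.
From mathcomp Require Import interval_inference ring lra zify.

Set Implicit Arguments.
Unset Strict Implicit.
Unset Printing Implicit Defensive.

Import Order.TTheory GRing.Theory Num.Theory.
Local Open Scope classical_set_scope.
Local Open Scope ring_scope.

(** * Convex hulls and their images under affine maps *)

Lemma convex_setP (R : realType) (d : nat) (A : set 'rV[R]_d) :
  convex_set A <->
  forall x y (t : R), A x -> A y -> 0 < t < 1 -> A (t *: x + (1 - t) *: y).
Proof.
split=> [cA x y t Ax Ay /andP[t0 t1]|cA].
  have := cA x y (Itv01 (ltW t0) (ltW t1)).
  by rewrite !inE; apply.
apply/convex_setW => x y; rewrite !inE => Ax Ay t t0 t1.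
by rewrite inE; apply: (cA x y t%:num) => //; rewrite t0 t1.
Qed.

Lemma convex_set_hull (R : realType) (d : nat) (A : set 'rV[R]_d) :
  convex_set (convex_hull A).
Proof.
apply/convex_setP => x y t hx hy t01 B [cB AB].
by move/convex_setP: (cB); apply=> //; [apply: hx|apply: hy].
Qed.

Lemma sub_convex_hull (R : realType) (d : nat) (A : set 'rV[R]_d) :
  A `<=` convex_hull A.
Proof. exact: sub_gen_smallest. Qed.

Lemma convex_hull_sub (R : realType) (d : nat) (A B : set 'rV[R]_d) :
  convex_set B -> A `<=` B -> convex_hull A `<=` B.
Proof. exact: smallest_sub. Qed.

Lemma affine_map_conv (R : realType) (d : nat) (M : 'M[R]_d)
    (v x y : 'rV[R]_d) (t : R) :
  (t *: x + (1 - t) *: y) *m M + v =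
  t *: (x *m M + v) + (1 - t) *: (y *m M + v).
Proof.
rewrite mulmxDl -!scalemxAl !scalerDr addrACA -scalerDl.
by rewrite [t + _]addrC subrK scale1r.
Qed.

Lemma affine_image_hull (R : realType) (d : nat) (M : 'M[R]_d) (v : 'rV[R]_d)
    (A : set 'rV[R]_d) :
  [set x *m M + v | x in convex_hull A] =
  convex_hull [set x *m M + v | x in A].
Proof.
apply/seteqP; split.
  move=> _ [x hx <-].
  apply: (convex_hull_sub (B := [set x | convex_hull [set x *m M + v | x in A]
    (x *m M + v)]) _ _ hx).
    apply/convex_setP => y z t /= hy hz t01; rewrite affine_map_conv.
    by have /convex_setP := @convex_set_hull R d [set x *m M + v | x in A]; apply.
  by move=> y Ay; apply: sub_convex_hull; exists y.
apply: convex_hull_sub.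
  apply/convex_setP => _ _ t [y hy <-] [z hz <-] t01.
  exists (t *: y + (1 - t) *: z); last exact: affine_map_conv.
  by have /convex_setP := @convex_set_hull R d A; apply.
by move=> _ [x Ax <-]; exists x => //; exact: sub_convex_hull.
Qed.

(** * Adjoining a point to a hull, and extreme points *)

(** Mixing two points of segments from [s] to [C] mixes their weights at [s], and convexity of [C]
    merges the rest into one point [w]. Membership in [C] is conditional on a weight below 1 so that
    the point [s] itself is covered even when [C] is empty. *)
Lemma join_convex (R : realType) (d : nat) (C : set 'rV[R]_d)
    (s y z : 'rV[R]_d) (l a b : R) :
  convex_set C -> 0 < l < 1 -> 0 <= a <= 1 -> 0 <= b <= 1 ->
  (a < 1 -> C y) -> (b < 1 -> C z) ->
  exists w, (l * a + (1 - l) * b < 1 -> C w) /\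
    l *: (a *: s + (1 - a) *: y) + (1 - l) *: (b *: s + (1 - b) *: z) =
    (l * a + (1 - l) * b) *: s + (1 - (l * a + (1 - l) * b)) *: w.
Proof.
move=> /convex_setP cC /andP[l0 l1] /andP[a0 a1] /andP[b0 b1] Cy Cz.
have split_s (g : R) (w : 'rV[R]_d) :
    l * (1 - a) *: y + (1 - l) * (1 - b) *: z = g *: w ->
    l *: (a *: s + (1 - a) *: y) + (1 - l) *: (b *: s + (1 - b) *: z) =
    (l * a + (1 - l) * b) *: s + g *: w.
  by move=> <-; rewrite !scalerDr !scalerA addrACA -scalerDl.
(* If one of the two points is [s], the far end of the other serves as [w]. *)
have [a_eq1|a_lt1] := eqVneq a 1.
  exists z; split; last first.
    apply: split_s; rewrite a_eq1 subrr mulr0 scale0r add0r.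
    by congr (_ *: _); ring.
  by move=> h; apply: Cz; nra.
have [b_eq1|b_lt1] := eqVneq b 1.
  exists y; split; last first.
    apply: split_s; rewrite b_eq1 subrr mulr0 scale0r addr0.
    by congr (_ *: _); ring.
  by move=> h; apply: Cy; nra.
have {}a_lt1 : 0 < 1 - a by rewrite subr_gt0 lt_neqAle a_lt1.
have {}b_lt1 : 0 < 1 - b by rewrite subr_gt0 lt_neqAle b_lt1.
have {}l1 : 0 < 1 - l by rewrite subr_gt0.
set g := 1 - (l * a + _).
have gE : g = l * (1 - a) + (1 - l) * (1 - b) by rewrite /g; ring.
have u0 : 0 < l * (1 - a) by exact: mulr_gt0.
have u1 : 0 < (1 - l) * (1 - b) by exact: mulr_gt0.
have g0 : 0 < g by rewrite gE addr_gt0.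
(* The weights of [y] and [z], divided by their sum [g]. *)
exists (l * (1 - a) / g *: y + (1 - l * (1 - a) / g) *: z); split.
  move=> _; apply: cC; [by apply: Cy; lra|by apply: Cz; lra|].
  by rewrite divr_gt0//= ltr_pdivrMr// mul1r gE ltrDl.
have gK : g * (l * (1 - a) / g) = l * (1 - a) by rewrite mulrC divfK ?gt_eqF.
apply: split_s; rewrite scalerDr !scalerA [g * (1 - _)]mulrBr mulr1 gK.
by congr (_ + _ *: _); rewrite gE; ring.
Qed.

Lemma convex_hull_setU1 (R : realType) (d : nat) (s x : 'rV[R]_d)
    (A : set 'rV[R]_d) :
  convex_hull (s |` A) x ->
  exists t y, [/\ 0 <= t <= 1, t < 1 -> convex_hull A y &
    x = t *: s + (1 - t) *: y].
Proof.
move=> hx; pose J := [set x | exists t y, [/\ 0 <= t <= 1,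
  t < 1 -> convex_hull A y & x = t *: s + (1 - t) *: y]].
apply: (convex_hull_sub (B := J) _ _ hx).
  apply/convex_setP => _ _ l [a [y [a01 Cy ->]]] [b [z [b01 Cz ->]]] l01.
  have [w [Cw ->]] := join_convex s (convex_set_hull (A := A)) l01 a01 b01 Cy Cz.
  exists (l * a + (1 - l) * b), w; split=> //.
  move/andP: l01 a01 b01 => [? ?] /andP[? ?] /andP[? ?].
  by apply/andP; split; nra.
move=> u [->|Au].
  by exists 1, s; rewrite lexx ler01 ltxx subrr scale0r addr0 scale1r.
exists 0, u; split; first by rewrite lexx ler01.
- by move=> _; exact: sub_convex_hull.
- by rewrite subr0 scale0r add0r scale1r.
Qed.

(** Deleting an extreme point from a convex set leaves it convex. If the point were outside [A], the
    hull without it would still be a convex set containing [A]. *)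
Lemma vertices_convex_hull (R : realType) (d : nat) (A : set 'rV[R]_d) :
  vertices (convex_hull A) `<=` A.
Proof.
move=> x [hx extx]; apply: contrapT => nAx.
suff : ([set y | convex_hull A y /\ y <> x]) x by case.
apply: (convex_hull_sub _ _ hx).
  apply/convex_setP => y z t [hy nyx] [hz nzx] t01; split.
    by have /convex_setP := @convex_set_hull R d A; apply.
  move=> e; have yz := extx y z t hy hz t01 (esym e).
  by apply: nyx; rewrite -e -yz -scalerDl addrC subrK scale1r.
by move=> y Ay; split; [exact: sub_convex_hull|move=> yx; apply: nAx; rewrite -yx].
Qed.

(** If [s] lies between two points of the hull, then [s] is [g *: s + (1 - g) *: w]. A weight
    [g < 1] would give [s = w], a point of the hull of [A]; so [g] is 1, which forces [a = b = 1],
    and both endpoints are [s]. *)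
Lemma extreme_of_minimal (R : realType) (d : nat) (s : 'rV[R]_d)
    (A : set 'rV[R]_d) :
  ~ convex_hull A s -> vertices (convex_hull (s |` A)) s.
Proof.
move=> nAs; split; first by apply: sub_convex_hull; left.
move=> _ _ l /convex_hull_setU1[a [y [a01 Cy ->]]]
  /convex_hull_setU1[b [z [b01 Cz ->]]] l01.
have [w [Cw ->]] := join_convex s (convex_set_hull (A := A)) l01 a01 b01 Cy Cz.
set g := l * a + _ => sE.
have [g1|g1] := ltP g 1.
  case: nAs; suff -> : s = w by exact: Cw.
  apply: (scalerI (lt0r_neq0 (_ : 0 < 1 - g))); first by rewrite subr_gt0.
  by rewrite scalerBl scale1r {1}sE addrC addKr.
have [aE bE] : a = 1 /\ b = 1.
  move/andP: l01 a01 b01 g1 => [? ?] /andP[? ?] /andP[? ?]; rewrite /g => ?.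
  by split; nra.
by rewrite aE bE subrr !scale0r.
Qed.

Lemma lattice_polytope_vertices (R : realType) (d : nat) (P : set 'rV[R]_d) :
  lattice_polytope P ->
  exists s : seq 'rV[int]_d, [/\ uniq s,
    vertices P = @of_lattice R d @` [set` s] & P = convex_hull (vertices P)].
Proof.
move=> [s0 P0].
(* The points of a generating sequence of minimal size are all extreme. *)
pose gen k := `[< exists s : seq 'rV[int]_d,
  size s = k /\ P = convex_hull (@of_lattice R d @` [set` s]) >].
have exgen : exists k, gen k by exists (size s0); apply/asboolP; exists s0.
case: (ex_minnP exgen) => k /asboolP[s [sk Ps]] mink.
suff vE : vertices P = @of_lattice R d @` [set` s].
  exists (undup s); split; [exact: undup_uniq| |by rewrite vE].
  by rewrite vE; congr image; apply/seteqP; split=> x /=; rewrite mem_undup.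
apply/seteqP; split; first by rewrite {1}Ps; exact: vertices_convex_hull.
move=> _ [x /= xs <-].
have sE : @of_lattice R d @` [set` s] =
    of_lattice R x |` (@of_lattice R d @` [set` rem x s]).
  have memE := perm_mem (perm_to_rem xs); apply/seteqP.
  split=> [_ [y /= ys <-]|y].
    by move: ys; rewrite memE inE => /orP[/eqP->|ys]; [left|right; exists y].
  case=> [->|[z /= zs <-]]; first by exists x.
  by exists z => //=; rewrite memE inE zs orbT.
(* Were [x] in the hull of the remaining points, dropping it would leave a generating sequence of
   size [k.-1]. *)
rewrite Ps sE; apply: extreme_of_minimal => hx.
have k0 : (0 < k)%N by rewrite -sk; case: (s) xs.
suff : (k <= k.-1)%N by lia.
apply: mink; apply/asboolP; exists (rem x s); split; first by rewrite size_rem// sk.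
rewrite Ps sE; apply/seteqP; split; apply: convex_hull_sub.
- exact: convex_set_hull.
- by move=> y [->//|]; exact: sub_convex_hull.
- exact: convex_set_hull.
- by move=> y hy; apply: sub_convex_hull; right.
Qed.

(** * Primitive integer vectors *)

Lemma biggcdn_Bezout (I : finType) (w : I -> int) :
  exists u : I -> int,
    (\big[gcdn/0%N]_i `|w i|%N)%:Z = \sum_i u i * w i.
Proof.
apply: (big_ind (fun g : nat => exists u : I -> int, g%:Z = \sum_i u i * w i)).
- by exists (fun=> 0); rewrite big1// => i _; rewrite mul0r.
- move=> x y [u ux] [v vy]; have [a [b ab]] := Bezoutz x y.
  exists (fun i => a * u i + b * v i).
  rewrite (_ : (gcdn x y)%:Z = gcdz x y)// -ab ux vy !big_distrr -big_split/=.
  by apply: eq_bigr => i _; rewrite mulrDl !mulrA.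
- move=> i _; exists (fun j => if j == i then sgz (w i) else 0).
  rewrite (bigD1 i)//= eqxx big1 ?addr0; last first.
    by move=> j /negPf ->; rewrite mul0r.
  exact: abszEsg.
Qed.

Lemma exists_primitive (I : finType) (w : {ffun I -> int}) (i0 : I) :
  w i0 != 0 ->
  exists (g : int) (w' : {ffun I -> int}),
    [/\ g != 0, primitive w' & w = [ffun i => g * w' i]].
Proof.
move=> wi0; set g := \big[gcdn/0%N]_i `|w i|%N.
have gdvd i : (g%:Z %| w i)%Z.
  by rewrite dvdzE /= /g (bigD1 i)//= dvdn_gcdl.
have g0 : (0 < g)%N.
  rewrite lt0n; apply: contra wi0 => /eqP g0.
  by have := gdvd i0; rewrite g0 dvd0z.
pose w' := [ffun i => (w i %/ g%:Z)%Z]; exists g%:Z, w'.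
have wE i : w i = g%:Z * w' i by rewrite ffunE mulrC divzK.
split; first by rewrite eqz_nat -lt0n.
(* Multiplying by [g] and moving it inside the gcd turns the claim into the definition of [g]. *)
- apply/eqP; rewrite -(eqn_pmul2l g0) muln1 {2}/g; apply/eqP.
  rewrite (big_morph (muln g) (muln_gcdr g) (muln0 g)).
  by apply: eq_bigr => i _; rewrite wE abszM.
- by apply/ffunP => i; rewrite ffunE wE.
Qed.

(** Bezout coefficients [b] with [\sum_i b i * w i = 1] give [c = \sum_i b i * u i], so the scalar
    [c] is an integer. *)
Lemma primitive_integral (F : numFieldType) (I : finType)
    (w u : {ffun I -> int}) (c : F) :
  primitive w -> (forall i, (u i)%:~R = c * (w i)%:~R) ->
  exists k : int, u = [ffun i => k * w i].
Proof.
move=> pw uE; have [b] := biggcdn_Bezout w; rewrite pw => bE.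
exists (\sum_i b i * u i); apply/ffunP => i; rewrite ffunE.
apply: (@intr_inj F); rewrite uE intrM; congr (_ * _).
rewrite rmorph_sum /=.
under eq_bigr do rewrite intrM uE mulrCA -intrM.
by rewrite -big_distrr -rmorph_sum /= -bE mulr1.
Qed.

(** * Maximal minors and Cramer's rule *)

(** Laplace expansion along row [i]: the cofactors of that row do not change when row [j] of [M] is
    put in its place. *)
Lemma mul_mx_adj_rowsub (F : comNzRingType) (n k : nat) (M : 'M[F]_(n, k))
    (f : 'I_k -> 'I_n) (j : 'I_n) (i : 'I_k) :
  (M *m \adj (rowsub f M)) j i =
  \det (rowsub (fun l => if l == i then j else f l) M).
Proof.
rewrite (expand_det_row _ i) mxE; apply: eq_bigr => l _.
rewrite !mxE eqxx; congr (_ * ((-1) ^+ _ * \det _)).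
by apply/matrixP => a b; rewrite !mxE eq_sym (negPf (neq_lift _ _)).
Qed.

(** By Cramer's rule the entries of [N *m \adj N1] and [M *m \adj M1] are minors, so these products
    differ by the factor [c]. Multiplying on the right by [N1] recovers [N] up to
    [\det N1 = c * \det M1]. *)
Lemma proportional_minors (F : fieldType) (n k : nat) (M N : 'M[F]_(n, k))
    (c : F) (f0 : 'I_k -> 'I_n) :
  c != 0 -> \det (rowsub f0 M) != 0 ->
  (forall f : 'I_k -> 'I_n, \det (rowsub f N) = c * \det (rowsub f M)) ->
  exists B, N = M *m B.
Proof.
move=> c0 M0 minor; set M1 := rowsub f0 M in M0; set N1 := rowsub f0 N.
have N0 : \det N1 != 0 by rewrite minor mulf_neq0.
have adjE : N *m \adj N1 = c *: (M *m \adj M1).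
  by apply/matrixP => j i; rewrite mul_mx_adj_rowsub minor mxE mul_mx_adj_rowsub.
(* This is the inverse of [M1] times [N1]. *)
exists ((\det M1)^-1 *: (\adj M1 *m N1)).
apply: (scalerI N0); rewrite -mul_mx_scalar -mul_adj_mx mulmxA adjE.
rewrite -scalemxAl -scalemxAr scalerA minor mulfK//.
by rewrite mulmxA.
Qed.

Lemma exists_increasing (n d : nat) (f : 'I_d.+1 -> 'I_n) :
  injective f ->
  exists (I : vol_index n d) (s : 'S_d.+1), forall i, f i = tnth (val I) (s i).
Proof.
move=> injf; pose r := [tuple f i | i < d.+1].
pose le (x y : 'I_n) := (x <= y)%N.
have sz : size (sort le r) == d.+1 by rewrite size_sort size_tuple.
have letot : total le by move=> x y; exact: leq_total.
have ur : uniq r by rewrite map_inj_uniq ?enum_uniq.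
have inc : increasing (Tuple sz).
  rewrite /increasing /= ltn_sorted_uniq_leq map_inj_uniq; last exact: val_inj.
  by rewrite sort_uniq ur sorted_map; exact: sort_sorted.
have /tuple_permP[s sE] : perm_eq r (Tuple sz) by rewrite perm_sym perm_sort.
exists (Sub (Tuple sz) inc), s => i.
have /(congr1 (fun t => tnth t i)) := val_inj sE.
by rewrite !tnth_mktuple.
Qed.

(** A choice of rows with a repetition has zero minor in both matrices; any other is a permutation
    of an increasing one, with the same sign on both sides. Cramer's rule needs this generality,
    since replacing a row breaks the order. *)
Lemma minors_of_increasing (F : comNzRingType) (n d : nat)
    (M N : 'M[F]_(n, d.+1)) (c : F) :
  (forall I : vol_index n d,
     \det (rowsub (tnth (val I)) N) = c * \det (rowsub (tnth (val I)) M)) ->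
  forall f : 'I_d.+1 -> 'I_n, \det (rowsub f N) = c * \det (rowsub f M).
Proof.
move=> incE f; have [injf|/injectivePn[i [j ij fij]]] := altP (injectiveP f).
  have [I [s fE]] := exists_increasing injf.
  have permE (K : 'M[F]_(n, d.+1)) :
      rowsub f K = row_perm s (rowsub (tnth (val I)) K).
    by apply/matrixP => a b; rewrite !mxE fE.
  by rewrite !permE !row_permE !det_mulmx incE mulrCA.
have det0 (K : 'M[F]_(n, d.+1)) : \det (rowsub f K) = 0.
  by apply: (determinant_alternate ij) => b; rewrite !mxE fij.
by rewrite !det0 mulr0.
Qed.

(** * Homogeneous coordinates and volume vectors *)

(** The leading 1 turns affine maps into right multiplication by a matrix. *)
Definition homog (F : pzRingType) (n d : nat) (p : 'I_n -> 'rV[F]_d) :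
    'M[F]_(n, 1 + d) :=
  \matrix_i row_mx 1%:M (p i).

Lemma homog_affine (F : pzRingType) (n d : nat) (p : 'I_n -> 'rV[F]_d)
    (A : 'M[F]_d) (v : 'rV[F]_d) :
  homog (fun i => p i *m A + v) = homog p *m block_mx 1%:M v 0 A.
Proof.
apply/row_matrixP => i; rewrite row_mul !rowK mul_row_block !mul1mx mulmx0 addr0.
by rewrite addrC.
Qed.

(** Comparing the last [d] columns reads off an affine map with linear part [drsubmx B] and
    translation [ursubmx B]. *)
Lemma homog_mulmx (F : pzRingType) (n d : nat) (p q : 'I_n -> 'rV[F]_d)
    (B : 'M[F]_(1 + d)) :
  homog q = homog p *m B -> forall i, q i = p i *m drsubmx B + ursubmx B.
Proof.
move=> e i; move/(congr1 (row i)): e; rewrite row_mul !rowK -{1}[B]submxK.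
by rewrite mul_row_block !mul1mx => /eq_row_mx[_ ->]; rewrite addrC.
Qed.

Lemma volume_vectorE (R : realType) (n d : nat) (p : 'I_n -> 'rV[int]_d)
    (I : vol_index n d) :
  (volume_vector p I)%:~R =
  \det (rowsub (tnth (val I)) (homog (fun i => of_lattice R (p i)))).
Proof.
rewrite ffunE -det_map_mx -det_tr; congr (\det _).
rewrite map_col_mx tr_col_mx; apply/row_matrixP => i.
rewrite row_rowsub rowK; apply/rowP => j; rewrite !mxE.
by case: splitP => k _; rewrite !mxE // ord1 eqxx.
Qed.

Lemma of_lattice_inj (R : realType) (d : nat) : injective (@of_lattice R d).
Proof.
move=> x y xy; apply/rowP => i; apply: (@intr_inj R).
by have /rowP/(_ i) := xy; rewrite !mxE.
Qed.

(** * Consequences of full dimension *)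

(** The affine hull of [P] is the whole space, and an affine functional vanishing on [P] vanishes
    there too; its values at 0 and at the unit vectors are then zero. *)
Lemma full_dim_affine_functional (R : realType) (d : nat) (P : set 'rV[R]_d)
    (c : R) (u : 'cV[R]_d) :
  has_dim P d -> (forall x, P x -> c + (x *m u) 0 0 = 0) -> c = 0 /\ u = 0.
Proof.
move=> [x0 [U [dimU affP]]] vanP.
have affT x : affine_hull P x.
  rewrite affP; exists (x - x0); last by rewrite addrC subrK.
  have /eqP -> : U == fullv by rewrite eqEdim subvf dimU dimvf /dim /= mul1n.
  exact: memvf.
have van (x : 'rV[R]_d) : c + (x *m u) 0 0 = 0.
  have [m [a [y [Py a1 ->]]]] := affT x.
  (* The weights sum to 1, so [c] is spread over the terms as [a i * c]. *)
  rewrite mulmx_suml summxE -[c]mul1r -a1 mulr_suml -big_split big1//= => i _.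
  by rewrite -scalemxAl mxE -mulrDr vanP ?mulr0.
have c0 : c = 0 by have := van 0; rewrite mul0mx mxE addr0.
split=> //; apply/colP => i; rewrite mxE.
by have := van (delta_mx 0 i); rewrite c0 add0r -rowE mxE.
Qed.

(** A linear relation among the columns of [M] is an affine functional vanishing on all the points,
    hence on [P]. So [M] has full column rank and an invertible choice of rows. *)
Lemma exists_nonzero_volume (R : realType) (d n : nat) (P : set 'rV[R]_d)
    (p : 'I_n -> 'rV[int]_d) :
  has_dim P d -> P = convex_hull (range (fun i => of_lattice R (p i))) ->
  exists I, volume_vector p I != 0.
Proof.
move=> dimP Pp; set M := homog (fun i => of_lattice R (p i)).
have fullM : row_full M.
  rewrite /row_full -mxrank_tr; apply: contraT => nfree.
  have : kermx M^T != 0 by rewrite kermx_eq0.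
  move=> /rowV0Pn[v /sub_kermxP vM v0].
  have Mv i : lsubmx v 0 0 + (of_lattice R (p i) *m (rsubmx v)^T) 0 0 = 0.
    have := congr1 trmx vM; rewrite trmx0 trmx_mul trmxK => /(congr1 (row i)).
    rewrite row_mul rowK -[v]hsubmxK tr_row_mx mul_row_col mul1mx row0.
    by move/matrixP/(_ 0 0); rewrite hsubmxK mxE [X in X + _]mxE [RHS]mxE.
  have [c0 u0] : lsubmx v 0 0 = 0 /\ (rsubmx v)^T = 0.
    apply: (full_dim_affine_functional dimP) => x.
    rewrite Pp => hx; apply: (convex_hull_sub (B := [set x |
      lsubmx v 0 0 + (x *m (rsubmx v)^T) 0 0 = 0]) _ _ hx).
      apply/convex_setP => y z t /= vy vz _.
      have -> : ((t *: y + (1 - t) *: z) *m (rsubmx v)^T) 0 0 =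
          t * (y *m (rsubmx v)^T) 0 0 + (1 - t) * (z *m (rsubmx v)^T) 0 0.
        by rewrite mulmxDl -!scalemxAl mxE [X in X + _]mxE [X in _ + X]mxE.
      have -> : (y *m (rsubmx v)^T) 0 0 = - lsubmx v 0 0 by lra.
      have -> : (z *m (rsubmx v)^T) 0 0 = - lsubmx v 0 0 by lra.
      by ring.
    by move=> _ [i _ <-]; exact: Mv.
  move: v0; rewrite -[v]hsubmxK -[rsubmx v]trmxK u0 trmx0.
  rewrite (_ : lsubmx v = 0) ?row_mx0 ?eqxx//.
  by apply/rowP => i; rewrite ord1 c0 mxE.
apply: contrapT => noI.
have det0 : \det (rowsub (fullrankfun fullM) M) = 0.
  (* Comparing [M] with itself at factor 0 extends vanishing from increasing choices of rows to all
     choices. *)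
  rewrite (@minors_of_increasing _ _ _ M M 0) ?mul0r// => I.
  rewrite mul0r -volume_vectorE; apply/eqP; rewrite intr_eq0.
  by apply/negPn/negP => hI; apply: noI; exists I.
by have := fullrowsub_unit fullM; rewrite unitmxE unitfE det0 eqxx.
Qed.

Lemma vertices_affine_image (R : realType) (d : nat) (P : set 'rV[R]_d)
    (A : 'M[R]_d) (v : 'rV[R]_d) :
  A \in unitmx ->
  vertices [set x *m A + v | x in P] = [set x *m A + v | x in vertices P].
Proof.
move=> uA; have inj (x y : 'rV[R]_d) : x *m A + v = y *m A + v -> x = y.
  by move=> /addIr /(congr1 (mulmx^~ (invmx A))); rewrite !mulmxK.
apply/seteqP; split.
  move=> _ [[x Px <-] extx]; exists x => //; split=> // y z t Py Pz t01 xE.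
  apply: inj; apply: (extx _ _ t) => //; [by exists y|by exists z|].
  by rewrite xE affine_map_conv.
move=> _ [x [Px extx] <-]; split; first by exists x.
move=> _ _ t [y Py <-] [z Pz <-] t01; rewrite -affine_map_conv => /inj xE.
by rewrite (extx y z t).
Qed.

Theorem theorem2p4 (R : realType) (d : nat) (P Q : set 'rV[R]_d)
    (latP : lattice_polytope P) (dimP : has_dim P d)
    (latQ : lattice_polytope Q) (dimQ : has_dim Q d) :
  affinely_equivalent P Q <->
  exists (n : nat) (p q : 'I_n -> 'rV[int]_d),
    [/\ vertex_ordering P p,
        vertex_ordering Q q &
        exists w : {ffun vol_index n d -> int},
          primitive_volume_vector p w /\ primitive_volume_vector q w].
Proof.
have [sP [usP vP hP]] := lattice_polytope_vertices latP.
have [sQ [usQ vQ hQ]] := lattice_polytope_vertices latQ.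
split=> [[A [v PQ]]|[n [p [q [[injp pE] [injq qE] [w [[pw [k kE]] [_ [l lE]]]]]]]]].
  (* If [A *m u^T = 0], then [y *m u^T] is constant on the image [Q], and full dimension of [Q]
     gives [u = 0]. *)
  have uA : A \in unitmx.
    rewrite -unitmx_tr -row_free_unit -kermx_eq0.
    apply/contraT => /rowV0Pn[u /sub_kermxP uA /negP[]].
    have Au : A *m u^T = 0 by rewrite -[A]trmxK -trmx_mul uA trmx0.
    have [|_ u0] := @full_dim_affine_functional _ _ _ (- (v *m u^T) 0 0) u^T dimQ.
      move=> y; rewrite -PQ => -[x _ <-].
      by rewrite mulmxDl -mulmxA Au mulmx0 add0r addNr.
    by rewrite -[u]trmxK u0 trmx0.
  have vPQ : vertices Q = [set x *m A + v | x in vertices P].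
    by rewrite -PQ vertices_affine_image.
  pose p := tnth (in_tuple sP).
  have pvert i : vertices P (of_lattice R (p i)).
    by rewrite vP; exists (p i) => //=; exact: mem_tnth.
  (* The images of the vertices of [P] are vertices of [Q], hence lattice points; this orders the
     vertices of [Q] along with those of [P]. *)
  have /choice[q qE] : forall i, exists y : 'rV[int]_d,
      of_lattice R y = of_lattice R (p i) *m A + v.
    move=> i; have : vertices Q (of_lattice R (p i) *m A + v).
      by rewrite vPQ; exists (of_lattice R (p i)).
    by rewrite vQ => -[y _ yE]; exists y.
  have injp : injective p by apply/tuple_uniqP.
  have pE : range (fun i => of_lattice R (p i)) = vertices P.
    apply/seteqP; split=> [_ [i _ <-]//|]; rewrite vP => _ [y /= ys <-].
    by have /tnthP[i yE] : y \in in_tuple sP by []; exists i => //; rewrite yE.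
  exists (size sP), p, q; split; first by [].
    split.
      move=> i j qij; apply: injp; apply: (@of_lattice_inj R).
      have := qE i; rewrite qij qE => /addIr.
      by move=> /(congr1 (mulmx^~ (invmx A))); rewrite !mulmxK.
    rewrite vPQ -pE image_comp; apply: eq_imagel => i _; exact: qE.
  have [I0 I0P] : exists I, volume_vector p I != 0.
    by apply: (exists_nonzero_volume dimP); rewrite pE.
  have [g [w [g0 pw wE]]] := exists_primitive I0P.
  exists w; split; first by split=> //; exists g.
  (* The factor for [q] is a priori the real number [\det A * g]; primitivity of [w] makes it an
     integer. *)
  split=> //; apply: (primitive_integral (F := R) (c := \det A * g%:~R)) => // I.
  rewrite volume_vectorE (_ : homog _ =
    homog (fun i => of_lattice R (p i)) *m block_mx 1%:M v 0 A); last first.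
    by rewrite -homog_affine; congr homog; apply/funext => i; exact: qE.
  rewrite -mul_rowsub_mx det_mulmx -volume_vectorE wE ffunE.
  by rewrite (det_ublock 1%:M v A) det1 mul1r intrM mulrC mulrA.
have [I0 pI0] : exists I, volume_vector p I != 0.
  by apply: (exists_nonzero_volume dimP); rewrite pE.
have [I1 qI1] : exists I, volume_vector q I != 0.
  by apply: (exists_nonzero_volume dimQ); rewrite qE.
(* A nonzero coordinate of each volume vector makes [k] and [l] nonzero, so the minors for [q] are
   those for [p] times the nonzero ratio of [l] to [k]. *)
have k0 : k%:~R != 0 :> R.
  by rewrite intr_eq0; apply: contra pI0 => /eqP k0; rewrite kE ffunE k0 mul0r.
have l0 : l%:~R != 0 :> R.
  by rewrite intr_eq0; apply: contra qI1 => /eqP l0; rewrite lE ffunE l0 mul0r.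
have minor := @minors_of_increasing _ _ _ (homog (fun i => of_lattice R (p i)))
  (homog (fun i => of_lattice R (q i))) (l%:~R / k%:~R).
have [B BE] : exists B, homog (fun i => of_lattice R (q i)) =
    homog (fun i => of_lattice R (p i)) *m B.
  apply: (@proportional_minors _ _ _ _ _ (l%:~R / k%:~R) (tnth (val I0))).
  - by rewrite mulf_neq0 ?invr_eq0.
  - by rewrite -volume_vectorE intr_eq0.
  - apply: minor => I; rewrite -!volume_vectorE lE kE !ffunE !intrM.
    by rewrite mulrA divfK.
exists (drsubmx B), (ursubmx B).
rewrite hP hQ affine_image_hull -pE -qE image_comp; congr convex_hull.
by apply: eq_imagel => i _ /=; rewrite (homog_mulmx BE).
Qed.
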